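(* For any infinite computable tree $T\subseteq 2^{<\omega}$ with no computable (infinite) paths, there is a high-above ideal $\mathcal{I}$ such that no element of $\mathcal{I}$ computes an infinite path through $T$.
   Context: An ideal is a nonempty set $\mathcal{I}\subseteq 2^\omega$ such that if $X\in\mathcal{I}$ and $Y\leq_T X$ then $Y\in\mathcal{I}$, and if $X,Y\in\mathcal{I}$ then $X\oplus Y\in\mathcal{I}$. An ideal $\mathcal{I}$ is a high-above ideal if for every $A\in\mathcal{I}$ there is $B\in\mathcal{I}$ with $A<_T B$ and $A''\leq_T B'$. *)

(* Defs.v *)
From mathcomp Require Import all_boot.
From mathcomp Require Import boolp classical_sets cardinality.
From mathcomp Require Import zify.
From Stdlib Require Cantor.

Set Implicit Arguments.
Unset Strict Implicit.
Unset Printing Implicit Defensive.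

Local Open Scope classical_set_scope.

(* Points of 2^omega, also read as subsets of omega. *)
Notation binseq := (nat -> bool).

Definition npair (a b : nat) : nat := Cantor.to_nat (a, b).
Definition nfst (n : nat) : nat := (Cantor.of_nat n).1.
Definition nsnd (n : nat) : nat := (Cantor.of_nat n).2.

(* Programs for the unary partial functions that are partial recursive in an
   oracle.  Several arguments are passed through the bijection npair; the
   identity is [Pair Fst Snd]. *)
Inductive prog : Type :=
| Zero | Succ | Fst | Snd | Oracle
| Pair of prog & prog
| Comp of prog & prog
| Prec of prog & prog
| Mu of prog.

(* [eval X p n m]: program p with oracle X halts on input n with output m. *)
Fixpoint eval (X : binseq) (p : prog) (n m : nat) {struct p} : Prop :=
  match p with
  | Zero => m = 0
  | Succ => m = n.+1
  | Fst => m = nfst n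
  | Snd => m = nsnd n
  | Oracle => m = X n
  | Pair q r => exists a b, [/\ eval X q n a, eval X r n b & m = npair a b]
  | Comp q r => exists2 k, eval X r n k & eval X q k m
  | Prec q r =>
      (* F(a, 0) = q(a) and F(a, k+1) = r(a, (k, F(a, k))) *)
      let a := nfst n in
      (fix iter_prec (k v : nat) : Prop :=
         match k with
         | 0 => eval X q a v
         | k'.+1 =>
             exists2 u, iter_prec k' u & eval X r (npair a (npair k' u)) v
         end) (nsnd n) m
  | Mu q =>
      eval X q (npair n m) 0 /\
      forall k, k < m -> exists v, eval X q (npair n k) v.+1
  end.

(* Goedel numbering of programs. *)
Fixpoint progcode (p : prog) : nat :=
  match p with
  | Zero => 0
  | Succ => 1
  | Fst => 2
  | Snd => 3
  | Oracle => 4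
  | Pair q r => 4 * npair (progcode q) (progcode r) + 5
  | Comp q r => 4 * npair (progcode q) (progcode r) + 6
  | Prec q r => 4 * npair (progcode q) (progcode r) + 7
  | Mu q => 4 * progcode q + 8
  end.

Definition turing_le (Y X : binseq) : Prop :=
  exists p : prog, forall n, eval X p n (Y n).

Definition turing_lt (Y X : binseq) : Prop := turing_le Y X /\ ~ turing_le X Y.

Definition zeros : binseq := fun _ => false.

Definition computable (Y : binseq) : Prop := turing_le Y zeros.

Definition jump (X : binseq) : binseq :=
  fun e => `[< exists p m, progcode p = e /\ eval X p e m >].

Definition join (X Y : binseq) : binseq :=
  fun n => if odd n then Y n./2 else X n./2.

(* The bijection of 2^{<omega} with omega given by <> |-> 0 and
   s^b |-> 2 * code(s) + 1 + b. *)
Definition strcode (s : seq bool) : nat :=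
  foldl (fun c (b : bool) => 2 * c + 1 + b) 0 s.

Definition is_tree (T : seq bool -> bool) : Prop :=
  forall s t, prefix s t -> T t -> T s.

Definition infinite_tree (T : seq bool -> bool) : Prop :=
  infinite_set [set s | T s].

Definition computable_tree (T : seq bool -> bool) : Prop :=
  exists p : prog, forall s, eval zeros p (strcode s) (T s).

Definition path_through (T : seq bool -> bool) (P : binseq) : Prop :=
  forall n, T (mkseq P n).

Definition is_ideal (I : set binseq) : Prop :=
  [/\ I !=set0,
      forall X Y, I X -> turing_le Y X -> I Y
    & forall X Y, I X -> I Y -> I (join X Y)].

Definition high_above_ideal (I : set binseq) : Prop :=
  is_ideal I /\
  forall A, I A ->
    exists B, [/\ I B, turing_lt A B & turing_le (jump (jump A)) (jump B)].

Lemma nfst_pair a b : nfst (npair a b) = a.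
Proof. by rewrite /nfst /npair Cantor.cancel_of_to. Qed.

Lemma nsnd_pair a b : nsnd (npair a b) = b.
Proof. by rewrite /nsnd /npair Cantor.cancel_of_to. Qed.

Lemma npairK n : npair (nfst n) (nsnd n) = n.
Proof.
by rewrite /npair /nfst /nsnd -[RHS]Cantor.cancel_to_of; case: (Cantor.of_nat n).
Qed.

Lemma eval_fun X p n m m' : eval X p n m -> eval X p n m' -> m = m'.
Proof.
elim: p n m m' => [|||||q IHq r IHr|q IHq r IHr|q IHq r IHr|q IHq] n m m' /=;
  try by move=> -> ->.
- move=> [a [b [qa rb ->]]] [a' [b' [qa' rb' ->]]].
  by rewrite (IHq _ _ _ qa qa') (IHr _ _ _ rb rb').
- move=> [k rk qm] [k' rk' qm'].
  by rewrite -(IHr _ _ _ rk rk') in qm'; apply: IHq qm qm'.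
- elim: (nsnd n) m m' => [|k IHk] m m'; first exact: IHq.
  move=> [u Fu rm] [u' Fu' rm'].
  by rewrite -(IHk _ _ Fu Fu') in rm'; apply: IHr rm rm'.
- move=> [qm ltm] [qm' ltm']; case: (ltngtP m m') => // lt_m.
  + by have [v qv] := ltm' _ lt_m; have := IHq _ _ _ qm qv.
  + by have [v qv] := ltm _ lt_m; have := IHq _ _ _ qm' qv.
Qed.

Lemma progcode_inj : injective progcode.
Proof.
have npair_inj a b c d : npair a b = npair c d -> a = c /\ b = d.
  move=> e; split; first by rewrite -(nfst_pair a b) e nfst_pair.
  by rewrite -(nsnd_pair a b) e nsnd_pair.
by elim=> [|||||q IHq r IHr|q IHq r IHr|q IHq r IHr|q IHq]
  [|||||q' r'|q' r'|q' r'|q'] //= e; try lia;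
  first [ have /npair_inj[/IHq-> /IHr->] :
            npair (progcode q) (progcode r) = npair (progcode q') (progcode r')
            by lia
        | rewrite (IHq q'); last by lia ].
Qed.

Lemma strcode_inj : injective strcode.
Proof.
rewrite /strcode; elim/last_ind=> [|s b IHs]; elim/last_ind=> [|t c _] //;
  rewrite ?foldl_rcons /=; try by lia.
move=> e; have bc : b = c by case: b c e => [] []; lia.
by rewrite bc in e *; rewrite (IHs t) //; lia.
Qed.

(* Main.v *)
Require Import Defs.
From mathcomp Require Import all_boot.
From mathcomp Require Import boolp classical_sets cardinality.
From mathcomp Require Import zify.

Set Implicit Arguments.
Unset Strict Implicit.
Unset Printing Implicit Defensive.

(* It suffices to build, above any A computing no path through T, a set
   B = A (+) g computing no path such that B' computes a prescribed h, where h
   codes Y'' for all Y <=_T A at once: the ideal generated by an iteration of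
   this step is high-above.  The set g is generic among the functions whose
   columns converge to the values of h, hence h <=_T B' by the limit lemma.  If
   some finite condition admitted no extension preventing the functional p from
   computing a path from A (+) g, then every output that p gives on an extension
   of that condition would be an initial segment of a path, and every condition
   below it could be extended to make p converge on one more input; an
   A-recursive search through such extensions would then compute a path. *)

(** * Closure properties of the functions recursive in an oracle *)

Definition recursive_in (X : binseq) (F : nat -> nat) : Prop :=
  exists p, forall n, eval X p n (F n).

Definition recursive2_in (X : binseq) (F : nat -> nat -> nat) : Prop :=
  recursive_in X (fun z => F (nfst z) (nsnd z)).

Definition recursive3_in (X : binseq) (F : nat -> nat -> nat -> nat) : Prop :=
  recursive_in X (fun z => F (nfst z) (nfst (nsnd z)) (nsnd (nsnd z))).

Section Recursive.
Variable X : binseq.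
Local Notation rec := (recursive_in X).
Local Notation rec2 := (recursive2_in X).
Local Notation rec3 := (recursive3_in X).

Lemma rec_ext F G : F =1 G -> rec F -> rec G.
Proof. by move=> e [p pF]; exists p => n; rewrite -e. Qed.

Lemma rec_comp F G : rec F -> rec G -> rec (fun n => F (G n)).
Proof. by move=> [p pF] [q qG]; exists (Comp p q) => n /=; exists (G n). Qed.

Lemma rec_pair F G : rec F -> rec G -> rec (fun n => npair (F n) (G n)).
Proof.
by move=> [p pF] [q qG]; exists (Pair p q) => n /=; exists (F n), (G n).
Qed.

Lemma rec_fst F : rec F -> rec (fun n => nfst (F n)).
Proof. by apply: (rec_comp (F := nfst)); exists Fst. Qed.

Lemma rec_snd F : rec F -> rec (fun n => nsnd (F n)).
Proof. by apply: (rec_comp (F := nsnd)); exists Snd. Qed.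

Lemma rec_succ F : rec F -> rec (fun n => (F n).+1).
Proof. by apply: (rec_comp (F := succn)); exists Succ. Qed.

Lemma rec_id : rec id.
Proof.
by apply: (@rec_ext _ _ npairK); apply: rec_pair; [exists Fst | exists Snd].
Qed.

Lemma rec_const k : rec (fun=> k).
Proof. by elim: k => [|k IHk]; [exists Zero | apply: rec_succ]. Qed.

Lemma rec_oracle : rec (fun n => X n).
Proof. by exists Oracle. Qed.

Lemma rec2_app F G H :
  rec2 F -> rec G -> rec H -> rec (fun n => F (G n) (H n)).
Proof.
move=> rF rG rH; apply: rec_ext (rec_comp rF (rec_pair rG rH)) => n.
by rewrite /= nfst_pair nsnd_pair.
Qed.

Lemma rec3_app F G H K : rec3 F -> rec G -> rec H -> rec K ->
  rec (fun n => F (G n) (H n) (K n)).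
Proof.
move=> rF rG rH rK.
apply: rec_ext (rec_comp rF (rec_pair rG (rec_pair rH rK))) => n.
by rewrite /= !(nfst_pair, nsnd_pair).
Qed.

Lemma rec_iter N Q R : rec N -> rec Q -> rec3 R ->
  rec (fun n => nat_rect (fun=> nat) (Q n) (R n) (N n)).
Proof.
move=> rN [q qQ] [r rR].
(* [Prec] recurses on the second component of its own argument, so the counter is first split from
   the parameter; feeding in the pair of [n] and [N n] comes afterwards. *)
pose P z := nat_rect (fun=> nat) (Q (nfst z)) (R (nfst z)) (nsnd z).
have rP : rec P.
  exists (Prec q r) => z; rewrite /P /=.
  elim: (nsnd z) => [|k IHk] /=; first exact: qQ.
  set u := nat_rect _ _ _ k in IHk *; exists u => //.
  by have := rR (npair (nfst z) (npair k u)); rewrite !(nfst_pair, nsnd_pair).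
apply: rec_ext (rec_comp rP (rec_pair rec_id rN)) => n.
by rewrite /P nfst_pair nsnd_pair.
Qed.

Lemma rec_case N Q R : rec N -> rec Q -> rec2 R ->
  rec (fun n => if N n is k.+1 then R n k else Q n).
Proof.
move=> rN rQ rR.
apply: rec_ext (rec_iter (R := fun n k _ => R n k) rN rQ _) => [n|].
  by case: (N n).
exact: rec2_app rR (rec_fst rec_id) (rec_fst (rec_snd rec_id)).
Qed.

Lemma rec_if (b : nat -> bool) F G : rec b -> rec F -> rec G ->
  rec (fun n => if b n then F n else G n).
Proof.
move=> rb rF rG; apply: rec_ext (rec_case (R := fun n _ => F n) rb rG _).
  by move=> n; case: (b n).
exact: rec_comp rF (rec_fst rec_id).
Qed.

Lemma rec_pred F : rec F -> rec (fun n => (F n).-1).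
Proof.
move=> rF; apply: rec_ext (rec_case (R := fun _ k => k) rF (rec_const 0) _).
  by move=> n; case: (F n).
exact: rec_snd rec_id.
Qed.

Lemma rec_add F G : rec F -> rec G -> rec (fun n => F n + G n).
Proof.
move=> rF rG; apply: rec_ext (rec_iter (R := fun _ _ u => u.+1) rG rF _).
  by move=> n; elim: (G n) => [|k /= ->]; rewrite ?addn0 ?addnS.
exact: rec_succ (rec_snd (rec_snd rec_id)).
Qed.

Lemma rec_sub F G : rec F -> rec G -> rec (fun n => F n - G n).
Proof.
move=> rF rG; apply: rec_ext (rec_iter (R := fun _ _ u => u.-1) rG rF _).
  by move=> n; elim: (G n) => [|k /= ->]; rewrite ?subn0 ?subnS.
exact: rec_pred (rec_snd (rec_snd rec_id)).
Qed.

Lemma rec_eq0 F : rec F -> rec (fun n => F n == 0).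
Proof.
move=> rF; apply: rec_ext (rec_case (R := fun _ _ => 0) rF (rec_const 1) _).
  by move=> n; case: (F n).
exact: rec_const.
Qed.

Lemma rec_leq F G : rec F -> rec G -> rec (fun n => F n <= G n).
Proof. by move=> rF rG; apply: rec_eq0; apply: rec_sub. Qed.

Lemma rec_and (b c : nat -> bool) : rec b -> rec c -> rec (fun n => b n && c n).
Proof.
move=> rb rc; apply: rec_ext (rec_if rb rc (rec_const 0)) => n.
by case: (b n).
Qed.

Lemma rec_not (b : nat -> bool) : rec b -> rec (fun n => ~~ b n).
Proof.
by move=> rb; apply: rec_ext (rec_eq0 rb) => n; case: (b n).
Qed.

Lemma rec_eq F G : rec F -> rec G -> rec (fun n => F n == G n).
Proof.
move=> rF rG; apply: rec_ext (rec_and (rec_leq rF rG) (rec_leq rG rF)) => n.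
by rewrite eqn_leq.
Qed.

Lemma rec_all N (b : nat -> nat -> bool) : rec N -> rec2 b ->
  rec (fun n => all (b n) (iota 0 (N n))).
Proof.
move=> rN rb.
pose R n k u : nat := if b n k then u else 0.
apply: rec_ext (rec_iter (R := R) rN (rec_const 1) _).
  move=> n; rewrite /R; elim: (N n) => [//|k IHk].
  by rewrite -[in RHS]addn1 iotaD all_cat /= IHk andbT andbC; case: (b n k).
apply: rec_if.
- exact: rec2_app rb (rec_fst rec_id) (rec_fst (rec_snd rec_id)).
- exact: rec_snd (rec_snd rec_id).
- exact: rec_const.
Qed.

Lemma rec_search (b : nat -> nat -> bool) :
  rec2 b -> (forall n, exists k, b n k) ->
  exists2 G, rec G & forall n, b n (G n).
Proof.
move=> rb ex_b; exists (fun n => ex_minn (ex_b n)); last first.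
  by move=> n; case: ex_minnP.
(* [Mu] looks for a zero, hence the negation of [b]. *)
have [p pb] := rec_not rb; exists (Mu p) => n /=.
case: ex_minnP => m bm min_m; split.
  by have := pb (npair n m); rewrite nfst_pair nsnd_pair bm.
move=> k lt_km; exists 0; have := pb (npair n k).
rewrite nfst_pair nsnd_pair; case: (b n k) (min_m k) => // /(_ isT).
by rewrite leqNgt lt_km.
Qed.

(** Finitely many values of an arbitrary [F] can be hard-wired into a program. This makes finite
    parts of non-recursive objects such as [h] available to any oracle. *)
Lemma rec_trunc F l : rec (fun n => if n < l then F n else 0).
Proof.
elim: l => [|l IHl]; first exact: rec_const.
apply: rec_ext (rec_if (rec_eq rec_id (rec_const l)) (rec_const (F l)) IHl).
by move=> n; rewrite ltnS (leq_eqVlt n l) /=; case: eqVneq => [->|].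
Qed.

Lemma rec_odd F : rec F -> rec (fun n => odd (F n)).
Proof.
move=> rF.
apply: rec_ext (rec_iter (R := fun _ _ u => u == 0) rF (rec_const 0) _).
  by move=> n; elim: (F n) => [|k /= ->] //=; case: (odd k).
exact: rec_eq0 (rec_snd (rec_snd rec_id)).
Qed.

Lemma rec_half F : rec F -> rec (fun n => (F n)./2).
Proof.
move=> rF.
apply: rec_ext (rec_iter (R := fun _ k u => odd k + u) rF (rec_const 0) _).
  by move=> n; elim: (F n) => [|k /= ->] //=; rewrite uphalf_half.
apply: rec_add (rec_snd (rec_snd rec_id)).
exact: rec_odd (rec_fst (rec_snd rec_id)).
Qed.

End Recursive.

(** * Turing reducibility and joins *)

Section Turing.
Implicit Types X Y Z A B : binseq.

Lemma rec_trans X Y F : turing_le Y X -> recursive_in Y F -> recursive_in X F.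
Proof.
move=> [q qY] [p pF].
pose subst := fix subst p := match p with
  | Oracle => q
  | Pair p r => Pair (subst p) (subst r)
  | Comp p r => Comp (subst p) (subst r)
  | Prec p r => Prec (subst p) (subst r)
  | Mu p => Mu (subst p)
  | p => p end.
exists (subst p) => n; move: n (F n) (pF n) => {F pF} n m.
elim: p n m => //=
  [n m -> //|p IHp r IHr n m|p IHp r IHr n m|p IHp r IHr n|p IHp n m].
- move=> [a [b [pa rb ->]]]; exists a, b; split; [exact: IHp|exact: IHr|by []].
- by move=> [k rk pm]; exists k; [apply: IHr | apply: IHp].
- elim: (nsnd n) => [|k IHk] m; first exact: IHp.
  by move=> [u uk rm]; exists u; [apply: IHk | apply: IHr].
- move=> [pm lt_m]; split; first exact: IHp.
  by move=> k /lt_m[v pv]; exists v; apply: IHp.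
Qed.

Lemma turing_le_refl X : turing_le X X.
Proof. by exists Oracle. Qed.

Lemma turing_le_trans X Y Z : turing_le X Y -> turing_le Y Z -> turing_le X Z.
Proof. by move=> XY YZ; apply: rec_trans YZ XY. Qed.

Lemma join_le X Y Z : turing_le X Z -> turing_le Y Z -> turing_le (join X Y) Z.
Proof.
move=> rX rY; have rh := rec_half (rec_id Z).
apply: rec_ext (rec_if (rec_odd (rec_id Z)) (rec_comp rY rh) (rec_comp rX rh)).
by move=> n; rewrite /join /=; case: (odd n).
Qed.

Lemma le_joinl X Y : turing_le X (join X Y).
Proof.
have rid := rec_id (join X Y).
apply: rec_ext (rec_comp (rec_oracle _) (rec_add rid rid)) => n.
by rewrite /join addnn odd_double doubleK.
Qed.

Lemma le_joinr X Y : turing_le Y (join X Y).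
Proof.
have rid := rec_id (join X Y).
apply: rec_ext (rec_comp (rec_oracle _) (rec_succ (rec_add rid rid))) => n.
by rewrite /join addnn /= odd_double /= uphalf_double.
Qed.

End Turing.

(** * The jump and the limit lemma *)

Fixpoint constp (n : nat) : prog :=
  if n is k.+1 then Comp Succ (constp k) else Zero.

Lemma eval_constp X k n m : eval X (constp k) n m <-> m = k.
Proof.
elim: k m => [|k IHk] m //=; split=> [[j /IHk-> ->] //|->].
by exists k => //; apply/IHk.
Qed.

Lemma rec_code_constp X q :
  recursive_in X (fun n => progcode (Comp q (constp n))).
Proof.
have r4 F : recursive_in X F -> recursive_in X (fun n => 4 * F n + 6).
  move=> rF; apply: rec_ext (rec_add (rec_add (rec_add rF rF) (rec_add rF rF))
    (rec_const X 6)) => n; lia.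
apply: (r4 _); apply: rec_pair; first exact: rec_const.
(* Here [0] and [1] are the codes of [Zero] and [Succ], and each round prefixes one more
   [Comp Succ]. *)
apply: rec_ext (rec_iter (R := fun _ _ u => 4 * npair 1 u + 6)
  (rec_id X) (rec_const X 0) _).
  by move=> n /=; elim: n => [|n /= ->].
apply: r4; apply: rec_pair; first exact: rec_const.
exact: rec_snd (rec_snd (rec_id X)).
Qed.

(** The composite ignores its input, so the diagonal halting question asked by [jump] turns into
    halting of [q] on [n]: an instance of the s-m-n theorem. *)
Lemma jump_code X q n :
  jump X (progcode (Comp q (constp n))) = `[< exists m, eval X q n m >].
Proof.
apply/asbool_equiv_eq; split.
  move=> [p [m [/progcode_inj-> /= [k /eval_constp-> qm]]]].
  by exists m.
by move=> [m qm]; exists (Comp q (constp n)), m; split=> //=; exists n => //;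
  apply/eval_constp.
Qed.

(** An unbounded search for a witness halts exactly when there is one, so one query to the jump
    decides the matter. *)
Lemma sigma1_le_jump X (b : nat -> nat -> bool) : recursive2_in X b ->
  recursive_in (jump X) (fun n => `[< exists t, b n t >]).
Proof.
move=> rb; have [p pb] := rec_not rb.
apply: rec_ext (rec_comp (rec_oracle (jump X)) (rec_code_constp _ (Mu p))) => n.
rewrite jump_code; congr nat_of_bool; apply/asbool_equiv_eq.
have pbE t : eval X p (npair n t) (~~ b n t).
  by have := pb (npair n t); rewrite nfst_pair nsnd_pair.
split=> [[t [p0 _]]|[t bt]].
  by exists t; have := eval_fun p0 (pbE t); case: (b n t).
have ex_b : exists t, b n t by exists t.
exists (ex_minn ex_b); case: ex_minnP => m bm min_m; split.
  by have := pbE m; rewrite bm.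
move=> k lt_km; exists 0; have := pbE k.
by case: (b n k) (min_m k) => // /(_ isT); rewrite leqNgt lt_km.
Qed.

(** The jump recognises pairs of a stage and a value such that the column never departs from the
    value after the stage. Searching for such a pair terminates, and its value has to be the
    limit. *)
Lemma limit_le_jump X (f : nat -> bool) (h : nat -> bool) : recursive_in X f ->
  (forall c, exists s0, forall s, s0 <= s -> f (npair c s) = h c) ->
  recursive_in (jump X) h.
Proof.
move=> rf lim_f.
pose b z t := f (npair (nfst z) (nfst (nsnd z) + t)) != nsnd (nsnd z) :> nat.
have rid := rec_id X.
have rb : recursive2_in X b.
  apply: rec_not; apply: rec_eq; last exact: rec_snd (rec_snd (rec_fst rid)).
  apply: rec_comp rf _; apply: rec_pair; first exact: rec_fst (rec_fst rid).
  exact: rec_add (rec_fst (rec_snd (rec_fst rid))) (rec_snd rid).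
have /rec_search[] : recursive2_in (jump X)
    (fun c w => ~~ `[< exists t, b (npair c w) t >]).
- apply: rec_not.
  by apply: rec_ext (sigma1_le_jump rb) => z; rewrite npairK.
- move=> c; have [s0 fs] := lim_f c.
  exists (npair s0 (h c)); apply/asboolPn => -[t].
  by rewrite /b !(nfst_pair, nsnd_pair) fs ?eqxx // leq_addr.
move=> G rG Gb; apply: rec_ext (rec_snd rG) => c.
have [s0 fs] := lim_f c.
have /asboolPn nb := Gb c; apply: contrapT => ne; apply: nb; exists s0.
rewrite /b !(nfst_pair, nsnd_pair) fs ?leq_addl //.
by apply/eqP => e; apply: ne; rewrite e.
Qed.

(** * Step-bounded evaluation and the use principle *)

(* Step-bounded evaluation: [0] means no answer yet, [m.+1] means output [m].
   The bound [s] also limits the oracle queries, so that it is a use bound.  In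
   the [Mu] loop, state [0] is searching, [1] is stuck, [m.+2] is found [m]. *)
Fixpoint ev (X : binseq) (s : nat) (p : prog) (n : nat) : nat :=
  match p with
  | Zero => 1
  | Succ => n.+2
  | Fst => (nfst n).+1
  | Snd => (nsnd n).+1
  | Oracle => if n < s then (X n).+1 else 0
  | Pair q r =>
      if ev X s q n is a.+1 then
        if ev X s r n is b.+1 then (npair a b).+1 else 0
      else 0
  | Comp q r => if ev X s r n is k.+1 then ev X s q k else 0
  | Prec q r =>
      nat_rect (fun=> nat) (ev X s q (nfst n))
        (fun k u =>
           if u is v.+1 then ev X s r (npair (nfst n) (npair k v)) else 0)
        (nsnd n)
  | Mu q =>
      (nat_rect (fun=> nat) 0
         (fun k st =>
            if st is _.+1 then st
            else if ev X s q (npair n k) is v.+1 then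
              if v is _.+1 then 0 else k.+2
            else 1) s).-1
  end.

Lemma ev_local X Y s p n :
  (forall i, i < s -> X i = Y i) -> ev X s p n = ev Y s p n.
Proof.
move=> XY.
elim: p n => //= [n|q IHq r IHr n|q IHq r IHr n|q IHq r IHr n|q IHq n].
- by case: ifP => // /XY->.
- by rewrite IHq; case: (ev Y s q n) => // a; rewrite IHr.
- by rewrite IHr; case: (ev Y s r n).
- elim: (nsnd n) => [|k /= ->]; first exact: IHq.
  by case: (nat_rect _ _ _ _).
- congr predn; elim: {2 4}s => [//|k /= ->].
  by rewrite IHq.
Qed.

Lemma ev_sound X s p n m : ev X s p n = m.+1 -> eval X p n m.
Proof.
elim: p n m => /=
  [||||n m|q IHq r IHr n m|q IHq r IHr n m|q IHq r IHr n|q IHq n m];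
  try by move=> n m [].
- by case: ifP => // _ [].
- case Eq: (ev X s q n) => [//|a]; case Er: (ev X s r n) => [//|b] [<-].
  by exists a, b; split; [apply: IHq | apply: IHr | ].
- case Er: (ev X s r n) => [//|k] /IHq qm.
  by exists k; first exact: IHr.
- elim: (nsnd n) => [|k IHk] m /=; first exact: IHq.
  case: (nat_rect _ _ _ _) IHk => [//|u] /(_ u erefl) ku /IHr rm.
  by exists u.
- set st := nat_rect _ _ _.
  (* State [1] carries no claim, since the final predecessor turns it into no answer. *)
  suff inv k :
               if st k is j.+1 then if j is i.+1 then eval X (Mu q) n i else True
               else forall i, i < k -> exists v, eval X q (npair n i) v.+1.
    by have := inv s; case: (st s) => [|[|i]] //= ? [<-].
  elim: k => [//|k] /=; case: (st k) => [lt_k|[|i] //].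
  case E: (ev X s q (npair n k)) => [//|[|v]].
    by split; first exact: IHq.
  move=> i; rewrite ltnS leq_eqVlt => /orP[/eqP->|/lt_k //].
  by exists v; apply: IHq.
Qed.

(** Convergence is claimed at all large bounds, not just at one, so that the bounds of
    subcomputations combine by taking maxima. *)
Lemma ev_complete X p n m : eval X p n m ->
  exists s0, forall s, s0 <= s -> ev X s p n = m.+1.
Proof.
elim: p n m => /=
  [||||n m|q IHq r IHr n m|q IHq r IHr n m|q IHq r IHr n|q IHq n m];
  try by move=> n m ->; exists 0.
- by move=> ->; exists n.+1 => s ->.
- move=> [a [b [/IHq[s1 qa] /IHr[s2 rb] ->]]]; exists (maxn s1 s2) => s.
  by rewrite geq_max => /andP[/qa-> /rb->].
- move=> [k /IHr[s1 rk] /IHq[s2 qm]]; exists (maxn s1 s2) => s.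
  by rewrite geq_max => /andP[/rk-> /qm].
- elim: (nsnd n) => [|k IHk] m; first exact: IHq.
  move=> [u /IHk[s1 ku] /IHr[s2 rm]]; exists (maxn s1 s2) => s /=.
  by rewrite geq_max => /andP[/ku-> /rm].
- move=> [/IHq[s1 q0] ltm].
  have [s2 Hs2] : exists s2, forall s, s2 <= s -> forall k, k < m ->
      exists v, ev X s q (npair n k) = v.+2.
    elim: m {q0 s1} ltm => [|m IHm] ltm; first by exists 0.
    have [k lt_km|s1 H1] := IHm; first by apply: ltm; apply: ltnW.
    have [v /IHq[s2 H2]] := ltm m (ltnSn m); exists (maxn s1 s2) => s.
    rewrite geq_max => /andP[/H1{}H1 /H2{}H2] k.
    by rewrite ltnS leq_eqVlt => /orP[/eqP->|/H1 //]; exists v.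
  (* State [k] reflects the tests below [k], so the answer [m] first shows at state [m.+1]. *)
  exists (maxn m.+1 (maxn s1 s2)) => s; rewrite !geq_max.
  move=> /and3P[lt_ms /q0{}q0 /Hs2{}Hs2]; set st := nat_rect _ _ _.
  have st0 k : k <= m -> st k = 0.
    by elim: k => [//|k IHk] lt_km /=; rewrite IHk ?(ltnW lt_km) //;
      have [v ->] := Hs2 _ lt_km.
  suff stm k : m < k -> st k = m.+2 by rewrite stm.
  elim: k => [//|k IHk]; rewrite ltnS leq_eqVlt => /orP[/eqP<-|/IHk /= ->//].
  by rewrite /= st0 // q0.
Qed.

Ltac rec_vars := repeat first
  [ exact: rec_id | exact: rec_const | apply: rec_fst | apply: rec_snd
  | apply: rec_pair | apply: rec_succ ].

(** The oracle is itself an argument, ranging over a uniformly [A]-recursive family; this lets [A]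
    search through possible oracles. *)
Lemma rec_ev A (O : nat -> binseq) p : recursive2_in A (fun c i => O c i) ->
  recursive3_in A (fun c s n => ev (O c) s p n).
Proof.
move=> rO.
elim: p => [|||||q IHq r IHr|q IHq r IHr|q IHq r IHr|q IHq];
  rewrite /recursive3_in /=; try by rec_vars.
- by apply: rec_if; [apply: rec_leq | apply: rec_succ; apply: (rec2_app rO) |];
    rec_vars.
- apply: (rec_case (R := fun z a => if ev (O (nfst z)) (nfst (nsnd z)) r
    (nsnd (nsnd z)) is b.+1 then (npair a b).+1 else 0) IHq (rec_const _ _)).
  apply: (rec_case (R := fun z b => (npair (nsnd z) b).+1) _ (rec_const _ _));
    last by rec_vars.
  by apply: (rec3_app IHr); rec_vars.
- apply: (rec_case (R := fun z k => ev (O (nfst z)) (nfst (nsnd z)) q k) IHr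
    (rec_const _ _)).
  by apply: (rec3_app IHq); rec_vars.
- apply: (rec_iter (R := fun z k u => if u is v.+1 then
    ev (O (nfst z)) (nfst (nsnd z)) r
      (npair (nfst (nsnd (nsnd z))) (npair k v)) else 0)).
  + by rec_vars.
  + by apply: (rec3_app IHq); rec_vars.
  + apply: (rec_case (R := fun y v => ev (O (nfst (nfst y)))
      (nfst (nsnd (nfst y))) r (npair (nfst (nsnd (nsnd (nfst y))))
      (npair (nfst (nsnd y)) v))) _ (rec_const _ _)); first by rec_vars.
    by apply: (rec3_app IHr); rec_vars.
- apply: rec_pred.
  apply: (rec_iter (R := fun z k st => if st is _.+1 then st
    else if ev (O (nfst z)) (nfst (nsnd z)) q
        (npair (nsnd (nsnd z)) k) is v.+1 then
      if v is _.+1 then 0 else k.+2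
    else 1)); [by rec_vars|by rec_vars|].
  apply: (rec_case (R := fun y _ => nsnd (nsnd y)));
    [by rec_vars| |by rec_vars].
  apply: (rec_case (R := fun y v => if v is _.+1 then 0
    else (nfst (nsnd y)).+2) _ (rec_const _ _)).
    by apply: (rec3_app IHq); rec_vars.
  by apply: (rec_case (R := fun _ _ => 0)); rec_vars.
Qed.

(** * Coded finite sequences and forcing conditions *)

(** Iterated pairing reads every number as an infinite list, with nonzero entries for true, so no
    length has to be decoded. *)
Definition finite_seq (c i : nat) : bool := nfst (iter i nsnd c) != 0.

Lemma finite_seq_dense (f : binseq) l :
  exists c, forall i, i < l -> finite_seq c i = f i.
Proof.
elim: l f => [|l IHl] f; first by exists 0.
have [c Hc] := IHl (fun i => f i.+1).
exists (npair (f 0) c) => -[_|i /Hc <-].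
  by rewrite /finite_seq /= nfst_pair; case: (f 0).
by rewrite /finite_seq iterSr nsnd_pair.
Qed.

Lemma rec_finite_seq X : recursive2_in X finite_seq.
Proof.
apply: rec_not; apply: rec_eq0; apply: rec_fst.
apply: rec_ext (rec_iter (R := fun _ _ u => nsnd u)
  (rec_snd (rec_id X)) (rec_fst (rec_id X)) _).
  by move=> z; elim: (nsnd z) => [|k /= ->].
by rec_vars.
Qed.

Lemma join_local A (f g : binseq) s : (forall i, i < s -> f i = g i) ->
  forall i, i < s -> join A f i = join A g i.
Proof.
move=> fg i lt_is; rewrite /join; case: ifP => // _; apply: fg; lia.
Qed.

(* A forcing condition: column [c] of [g] is [fun s => g (npair c s)], and from
   [l] on the columns [c < n] are frozen at their intended limit [h c]. *)
Definition cylinder (h f : binseq) (l n : nat) (g : binseq) : Prop :=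
  (forall i, i < l -> g i = f i) /\
  (forall i, l <= i -> nfst i < n -> g i = h (nfst i)).

Lemma cylinder_trans h f l n f' l' n' g : l <= l' -> n <= n' ->
  cylinder h f l n f' -> cylinder h f' l' n' g -> cylinder h f l n g.
Proof.
move=> le_l le_n [f_lo f_hi] [g_lo g_hi]; split=> i.
  by move=> lt_il; rewrite g_lo ?f_lo // (leq_trans lt_il).
move=> le_li lt_in; case: (ltnP i l') => [lt_il'|le_l'i].
  by rewrite g_lo ?f_hi.
by rewrite g_hi // (leq_trans lt_in).
Qed.

(** Neither [f] nor [h] need be recursive in [X]: only [l] values of the one and [n] values of the
    other are consulted. *)
Lemma rec_patch X (f h : binseq) l n : recursive2_in X (fun c i =>
  if i < l then f i else if nfst i < n then h (nfst i) else finite_seq c i).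
Proof.
have rid := rec_id X.
have rf := rec_comp (rec_trunc X (fun i => f i) l) (rec_snd rid).
have rh := rec_comp (rec_trunc X (fun i => h i) n) (rec_fst (rec_snd rid)).
have rl := rec_leq (rec_succ (rec_snd rid)) (rec_const X l).
have rn := rec_leq (rec_succ (rec_fst (rec_snd rid))) (rec_const X n).
apply: rec_ext (rec_if rl rf (rec_if rn rh (rec_finite_seq X))) => z.
by case: (nsnd z < l) => //; case: (nfst (nsnd z) < n).
Qed.

(** * Construction of the generic set *)

Section Forcing.
Variables (T : seq bool -> bool) (A h : binseq).
Hypothesis A_avoids : forall P, path_through T P -> ~ turing_le P A.

Lemma force_avoid p (f0 : binseq) l n :
  exists f l', [/\ l <= l', cylinder h f0 l n f &
    forall g P, cylinder h f l' n g -> path_through T P ->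
      ~ forall x, eval (join A g) p x (P x)].
Proof.
apply: contrapT => not_forced.
have {not_forced} ext f l' : l <= l' -> cylinder h f0 l n f ->
    exists g P, [/\ cylinder h f l' n g, path_through T P &
      forall x, eval (join A g) p x (P x)].
  move=> le_ll' Cf; apply: contrapT => no_g; apply: not_forced.
  exists f, l'; split=> // g P Cg TP gP; apply: no_g; by exists g, P.
(* The sequences [patch c] are dense in the cylinder and uniformly [A]-recursive, so a search over
   numbers [c] meets every finite extension of the condition. *)
pose patch c i :=
  if i < l then f0 i else if nfst i < n then h (nfst i) else finite_seq c i.
pose O c := join A (patch c).
have Cpatch c : cylinder h f0 l n (patch c).
  split=> i; rewrite /patch; first by move=> ->.
  by rewrite leqNgt => /negbTE-> ->.
have patch_dense g k : cylinder h f0 l n g ->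
    exists c, forall i, i < k -> patch c i = g i.
  move=> [g_lo g_hi]; have [c Hc] := finite_seq_dense g k.
  exists c => i lt_ik; rewrite /patch Hc //.
  case: ltnP => [/g_lo //|le_li]; case: ltnP => // lt_in.
  by rewrite g_hi.
have rO : recursive2_in A (fun c i => O c i).
  have rid := rec_id A.
  have rhalf := rec_half (rec_snd rid).
  apply: rec_ext (rec_if (rec_odd (rec_snd rid))
    (rec2_app (rec_patch A f0 h l n) (rec_fst rid) rhalf)
    (rec_comp (rec_oracle A) rhalf)) => z.
  by rewrite /O /join; case: ifP.
have eqb_nat (a b : bool) : (a == b :> nat) = (a == b) by case: a b => [] [].
pose val c s k := ev (O c) s p k.
have rval : recursive3_in A val by apply: rec_ev.
(* [u = (c, s)] stands for the string [O c] restricted to [s]; [check u k u']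
   says that [u'] extends [u] and makes [p] converge on [k] to a bit. *)
pose check u k u' := [&& nsnd u <= nsnd u',
  all (fun i => O (nfst u) i == O (nfst u') i :> nat) (iota 0 (nsnd u)),
  0 < val (nfst u') (nsnd u') k & val (nfst u') (nsnd u') k <= 2].
have /rec_search[] : recursive2_in A (fun v u' => check (nfst v) (nsnd v) u').
- apply: rec_and; first by apply: rec_leq; rec_vars.
  apply: rec_and.
    apply: (rec_all (b := fun w i =>
      O (nfst (nfst (nfst w))) i == O (nfst (nsnd w)) i :> nat)).
      by rec_vars.
    by apply: rec_eq; apply: (rec2_app rO); rec_vars.
  by apply: rec_and; apply: rec_leq; rec_vars; apply: (rec3_app rval); rec_vars.
- move=> v; move: (nfst v) (nsnd v) => u k {v}.
  (* Some [g] extending the current string computes a path, so [p] converges on [k] there. The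
     computation reads finitely much of [g], and some [patch c] agrees with [g] that far. *)
  have [|g [P [Cg TP gP]]] :=
    ext (patch (nfst u)) (maxn l (nsnd u)) _ (Cpatch _).
    exact: leq_maxl.
  have [s0 Hs0] := ev_complete (gP k).
  have [|c Hc] := patch_dense g (maxn s0 (nsnd u)).
    by apply: cylinder_trans (Cpatch _) Cg; rewrite ?leq_maxl.
  have vE : val c (maxn s0 (nsnd u)) k = (P k).+1.
    rewrite -(Hs0 (maxn s0 (nsnd u))) ?leq_maxl //.
    by apply: ev_local; apply: join_local.
  exists (npair c (maxn s0 (nsnd u))).
  rewrite /check nfst_pair nsnd_pair vE leq_maxr /=.
  rewrite ltnS leq_b1 andbT; apply/allP => i.
  rewrite mem_iota /= add0n => lt_i.
  rewrite eqb_nat; apply/eqP; apply: join_local (lt_i) => j lt_j.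
  rewrite Hc ?leq_max ?lt_j ?orbT //; case: Cg => -> //.
  by rewrite leq_max lt_j orbT.
move=> G rG Gcheck.
pose st k := nat_rect (fun=> nat) 0 (fun k u => G (npair u k)) k.
pose vst k := val (nfst (st k.+1)) (nsnd (st k.+1)) k.
have rst : recursive_in A st.
  apply: (rec_iter (R := fun _ k u => G (npair u k))); rec_vars.
  by apply: rec_comp rG _; rec_vars.
have step k : check (st k) k (st k.+1).
  by have := Gcheck (npair (st k) k); rewrite nfst_pair nsnd_pair.
(* Outputs of [ev] are shifted by one: [2] is the bit true, and [check] leaves only [1] for
   false. *)
pose P k := vst k == 2.
have rP : turing_le P A.
  apply: rec_eq (rec_const _ _).
  have rst1 := rec_comp rst (rec_succ (rec_id A)).
  by apply: (rec3_app rval); rec_vars.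
have vstE k : vst k = (P k).+1.
  have /and4P[_ _] := step k.
  by rewrite /P -/(vst k); case: (vst k) => [|[|[|]]].
have grow j k : j <= k -> nsnd (st j) <= nsnd (st k) /\
    forall i, i < nsnd (st j) -> O (nfst (st j)) i = O (nfst (st k)) i.
  elim: k => [|k IHk]; first by case: j.
  rewrite leq_eqVlt => /orP[/eqP->//|/IHk[le_s eqO]].
  have /and4P[le_s' /allP eqO' _ _] := step k.
  split; first exact: leq_trans le_s'.
  move=> i lt_i; rewrite eqO //; apply/eqP; rewrite -eqb_nat; apply: eqO'.
  by rewrite mem_iota (leq_trans lt_i).
apply: (A_avoids (P := P)) => // k.
(* The string reached at stage [k] extends to a [g] from which [p] computes a genuine path [Q]. That
   string already decides the bits of [P] below [k], so they are those of [Q]. *)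
have [|g [Q [[g_lo _] TQ gQ]]] :=
  ext (patch (nfst (st k))) (maxn l (nsnd (st k))) _ (Cpatch _).
  exact: leq_maxl.
suff -> : mkseq P k = mkseq Q k by [].
apply/eq_in_map => j; rewrite mem_iota /= add0n => lt_jk.
have [le_s eqO] := grow _ _ lt_jk.
have e : ev (join A g) (nsnd (st j.+1)) p j = (P j).+1.
  rewrite -vstE; apply: ev_local => i lt_i; rewrite eqO //.
  apply: join_local (leq_trans lt_i le_s) => {lt_i} i lt_i.
  by rewrite g_lo // leq_max lt_i orbT.
by have := eval_fun (ev_sound e) (gQ j); case: (P j) (Q j) => [] [].
Qed.

Lemma generic_limit : exists g : binseq,
  (forall c, exists s0, forall s, s0 <= s -> g (npair c s) = h c) /\
  (forall P, path_through T P -> ~ turing_le P (join A g)).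
Proof.
(* Stage [k] treats the program with code [k], if any, while the columns below [k] are frozen.
   Passing to stage [k.+1] freezes column [k] as well. *)
have forced (kc : nat * (binseq * nat)) : exists c : binseq * nat,
    [/\ kc.2.2 < c.2, cylinder h kc.2.1 kc.2.2 kc.1 c.1 &
      forall p g P, progcode p = kc.1 -> cylinder h c.1 c.2 kc.1 g ->
        path_through T P -> ~ forall x, eval (join A g) p x (P x)].
  case: kc => k [f0 l] /=.
  have [[p pk]|no_p] := pselect (exists p, progcode p = k).
    have [f [l' [le_l Cf Hf]]] := force_avoid p f0 l k.
    (* The successor forces strict growth, so that the prefixes exhaust all positions. *)
    exists (f, l'.+1); split=> //= q g P.
    rewrite -{1}pk => /progcode_inj-> Cg TP.
    apply: (Hf g P _ TP); apply: cylinder_trans (leqnSn _) (leqnn _) _ Cg.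
    by split=> // i le_l'i; case: Cf => _; apply; apply: leq_trans le_l'i.
  pose f i := if i < l then f0 i else h (nfst i).
  exists (f, l.+1); split=> //= [|p g P pk]; last by case: no_p; exists p.
  by split=> i; rewrite /f; [move=> -> | rewrite leqNgt => /negbTE->].
have {forced} [next nextP] := choice forced.
pose st k := nat_rect (fun=> (binseq * nat)%type) (zeros, 0)
  (fun k c => next (k, c)) k.
have {nextP} stP k := nextP (k, st k).
have st_lt k : (st k).2 < (st k.+1).2 by case: (stP k).
have st_ge k : k <= (st k).2 by elim: k => // k /leq_ltn_trans; apply.
pose g i := (st i.+1).1 i.
have st_mono : {homo (fun k => (st k).2) : j k / j <= k}.
  by apply: homo_leq => [//|? ? ?|k]; [apply: leq_trans | apply: ltnW].
have st_cyl j k : j <= k -> cylinder h (st j).1 (st j).2 j (st k.+1).1.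
  elim: k => [|k IHk]; first by case: j => // _; case: (stP 0).
  rewrite leq_eqVlt => /orP[/eqP->|le_jk]; first by case: (stP k.+1).
  have [_ Ck _] := stP k.+1; apply: (cylinder_trans _ _ (IHk le_jk) Ck).
    exact: st_mono (ltnW le_jk).
  exact: ltnW.
have g_cyl j : cylinder h (st j).1 (st j).2 j g.
  (* Any stage past both [i] and [j] gives the same bit at [i], which allows comparison with
     condition [j]. *)
  have gE i : g i = (st (i + j).+2).1 i.
    have [lo _] := st_cyl i.+1 (i + j).+1 (leq_addr j i.+1).
    by rewrite lo // (leq_trans _ (st_ge _)).
  have Cj i := st_cyl j (i + j).+1 (leqW (leq_addl i j)).
  by split=> i; rewrite gE; case: (Cj i) => lo hi; [apply: lo | apply: hi].
exists g; split.
  move=> c; exists (st c.+1).2 => s le_s; have [_ hi] := g_cyl c.+1.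
  rewrite hi ?nfst_pair //; apply: leq_trans le_s _.
  by have := Cantor.to_nat_non_decreasing c s; rewrite /npair; lia.
move=> P TP [p pP]; have [_ _] := stP (progcode p).
move=> /(_ p g P erefl) forced; apply: forced TP pP.
(* The forcing clause of a stage needs one frozen column fewer than the next condition provides. *)
have [lo hi] := g_cyl (progcode p).+1.
by split=> // i le_i lt_i; apply: hi => //; apply: leqW.
Qed.

End Forcing.

(** * One step of the iteration, and the ideal it generates *)

(** The columns [npair 0 (npair e i)] converge to the bits of the double jump of [reduct e], so the
    single jump of the join recovers these double jumps for all [Y] below [A]. *)
Lemma high_above_step (T : seq bool -> bool) A :
  (forall P, path_through T P -> ~ turing_le P A) ->
  exists B, [/\ turing_lt A B,
    forall Y, turing_le Y A -> turing_le (jump (jump Y)) (jump B) &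
    forall P, path_through T P -> ~ turing_le P B].
Proof.
move=> A_avoids.
(* This is defined for every [e], total program or not, and returns [Y] when [e] codes a reduction
   of [Y] to [A]. *)
pose reduct e : binseq :=
  fun i => `[< exists2 p, progcode p = e & eval A p i 1 >].
(* The columns [npair 1 e] diagonalize against the limits computed by [A], which
   keeps [g] from being [A]-recursive. *)
pose column_limit e := `[< exists2 p, progcode p = e &
  exists s0, forall s, s0 <= s -> eval A p (npair (npair 1 e) s) 1 >].
pose h c :=
  if nfst c == 0 then jump (jump (reduct (nfst (nsnd c)))) (nsnd (nsnd c))
  else ~~ column_limit (nsnd c).
have [g [lim_g g_avoids]] := generic_limit h A_avoids.
have h_le : turing_le h (jump (join A g)).
  exact: limit_le_jump (le_joinr A g) lim_g.
exists (join A g); split=> //.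
- split; first exact: le_joinl.
  move=> /(turing_le_trans (le_joinr A g)) [p pg].
  have [s0 hs0] := lim_g (npair 1 (progcode p)).
  have pgE s : s0 <= s ->
      eval A p (npair (npair 1 (progcode p)) s) (~~ column_limit (progcode p)).
    move=> le_s; have := pg (npair (npair 1 (progcode p)) s).
    by rewrite hs0 // /h nfst_pair nsnd_pair.
  case: (boolP (column_limit (progcode p))) pgE => [cl|/asboolPn ncl] pgE.
    move/asboolP: cl => [q /progcode_inj-> [s1 qs]].
    by have := eval_fun (qs _ (leq_maxr s0 s1)) (pgE _ (leq_maxl s0 s1)).
  by apply: ncl; exists p => //; exists s0.
- move=> Y [p pY].
  have YE : Y = reduct (progcode p).
    apply/funext => i; apply/esym; rewrite /reduct; apply/asboolP/idP.
      move=> [q /progcode_inj-> q1]; have := eval_fun q1 (pY i).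
      by case: (Y i).
    by move=> Yi; exists p => //; have := pY i; rewrite Yi.
  have rid := rec_id (jump (join A g)).
  apply: rec_ext (rec_comp h_le (rec_pair (rec_const _ 0)
    (rec_pair (rec_const _ (progcode p)) rid))) => n.
  by rewrite /h !(nfst_pair, nsnd_pair) /= -YE.
Qed.

Theorem proposition6p8 (T : seq bool -> bool) :
  is_tree T -> infinite_tree T -> computable_tree T ->
  (forall P : binseq, path_through T P -> ~ computable P) ->
  exists I : set binseq,
    high_above_ideal I /\
    (forall X P : binseq, I X -> path_through T P -> ~ turing_le P X).
Proof.
move=> _ _ _ T_avoids.
pose avoids A := forall P, path_through T P -> ~ turing_le P A.
have step A : exists B, avoids A -> [/\ turing_lt A B,
    forall Y, turing_le Y A -> turing_le (jump (jump Y)) (jump B) & avoids B].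
  have [/high_above_step[B BP]|nA] := pselect (avoids A); first by exists B.
  by exists A => /nA.
have {step} [next nextP] := choice step.
pose chain k := iter k next zeros.
have chain_avoids k : avoids (chain k).
  (* The base case is the hypothesis on [T], as computability means reducibility to [zeros]. *)
  by elim: k => [//|k IHk]; have [] := nextP _ IHk.
have chainP k := nextP _ (chain_avoids k).
have chain_mono : {homo chain : j k / j <= k >-> turing_le j k}.
  apply: homo_leq => [X|Y X Z XY YZ|k]; first exact: turing_le_refl.
    exact: turing_le_trans XY YZ.
  by have [[]] := chainP k.
exists (fun X => exists k, turing_le X (chain k)); split; last first.
  move=> X P [k Xk] TP PX; apply: (chain_avoids k P TP).
  exact: turing_le_trans PX Xk.
split; first split.
- by exists zeros, 0; apply: turing_le_refl.
- by move=> X Y [k Xk] YX; exists k; apply: turing_le_trans YX Xk.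
- move=> X Y [j Xj] [k Yk]; exists (maxn j k); apply: join_le.
    by apply: turing_le_trans Xj (chain_mono _ _ _); apply: leq_maxl.
  by apply: turing_le_trans Yk (chain_mono _ _ _); apply: leq_maxr.
(* A member of the ideal is only below some [chain k], which is why the step treats the double jumps
   of all sets below [A]; then [chain k.+1] serves for [Y]. *)
move=> Y [k Yk]; have [[le_next not_le] jj _] := chainP k.
exists (chain k.+1); split; [| |exact: jj].
- by exists k.+1; apply: turing_le_refl.
- split; first exact: turing_le_trans Yk le_next.
  by move=> le_Y; apply: not_le; apply: turing_le_trans le_Y Yk.
Qed.
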